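(* Let $G$ be a finitely generated group with $d(G)=n$, and let $H$ be a subgroup of finite index in $G$ with $[G:H] < 3 \cdot 2^{n-1}$. Then $H$ contains no primitive elements of $G$ if and only if $H$ is normal in $G$ and the quotient $G/H$ is isomorphic to $C_2^n$. Moreover, when this is the case, every coset of $H$ in $G$ distinct from $H$ contains a primitive element of $G$.
   Context: For a finitely generated group $G$, $d(G)$ (the rank of $G$) denotes the minimal number of elements in a generating set of $G$. If $d(G)=n$, an element of $G$ is called primitive if it lies in some generating set of size $n$ for $G$. $C_2^n$ denotes the direct product of $n$ copies of the cyclic group of order $2$. *)

(* Defs.v *)
From HB Require Import structures.
From mathcomp Require Import all_boot.
From mathcomp Require Import ssralg countalg finalg zmodp.
From mathcomp Require Import finmap.
From mathcomp Require Import all_classical.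

Set Implicit Arguments.
Unset Strict Implicit.
Unset Printing Implicit Defensive.

(* Groups are [groupType]s (possibly infinite); subsets of a group are
   Prop-valued sets [set G]. Since [group_closed] expects a boolean predicate,
   a set [H] is passed to it as [mem H], the (classical) membership predicate. *)

Local Open Scope classical_set_scope.
Local Open Scope group_scope.

Section Groups.
Variable G : groupType.
Implicit Types (A H C D : set G) (x y : G).

Definition is_subgroup H : Prop := group_closed (mem H).

Definition is_normal H : Prop :=
  is_subgroup H /\ forall x y, H x -> H (x ^ y).

Definition gen_subgroup A : set G := smallest is_subgroup A.

Definition generates (A : {fset G}) : Prop := gen_subgroup [set` A] = [set: G].

Definition finitely_generated : Prop := exists A : {fset G}, generates A.

Definition has_generating_set (k : nat) : bool :=
  `[< exists A : {fset G}, generates A /\ #|` A| = k >].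

Lemma has_generating_set_ex :
  finitely_generated -> exists k, has_generating_set k.
Proof. by case=> A genA; exists #|` A|; apply/asboolP; exists A. Qed.

Definition group_rank (fgG : finitely_generated) : nat :=
  ex_minn (has_generating_set_ex fgG).

Definition primitive_elt (fgG : finitely_generated) x : Prop :=
  exists A : {fset G}, [/\ generates A, #|` A| = group_rank fgG & x \in A].

Definition left_coset H x : set G := [set x * h | h in H].

Definition left_cosets H : set (set G) := range (left_coset H).

(* Only meaningful when [left_cosets H] is finite ([fset_set] is empty otherwise). *)
Definition subgroup_index H : nat := #|` fset_set (left_cosets H)|.

Lemma left_cosetE H x y : left_coset H x y = H (x^-1 * y).
Proof.
apply/propext; split=> [[h Hh <-]|Hy]; first by rewrite mulKg.
by exists (x^-1 * y) => //; rewrite mulVKg.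
Qed.

Definition set_mul C D : set G := [set c * d | c in C & d in D].
Definition set_inv C : set G := [set c^-1 | c in C].

Section NormalTheory.
Variables (H : set G) (nH : is_normal H).

Lemma normal1 : H 1.
Proof. by have [[+ _] _] := nH => /set_mem. Qed.

Lemma normalF x y : H x -> H y -> H (x / y).
Proof. by have [[_ HF] _] := nH => Hx Hy; apply/set_mem/HF; apply/mem_set. Qed.

Lemma normalV x : H x -> H x^-1.
Proof. by move=> Hx; rewrite -div1g; apply: normalF => //; apply: normal1. Qed.

Lemma normalM x y : H x -> H y -> H (x * y).
Proof. by move=> Hx Hy; rewrite -[y]invgK; apply/normalF/normalV. Qed.

Lemma normalJ x y : H x -> H (x ^ y).
Proof. by case: nH => _; apply. Qed.

Lemma left_coset1 : left_coset H 1 = H.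
Proof. by apply/funext => y; rewrite left_cosetE invg1 mul1g. Qed.

Lemma set_mul_left_coset x y :
  set_mul (left_coset H x) (left_coset H y) = left_coset H (x * y).
Proof.
apply/seteqP; split=> z /=.
  case=> _ [h Hh <-] [_ [k Hk <-] <-].
  exists (h ^ y * k); first exact/normalM/Hk/normalJ.
  by rewrite /conjg -!mulgA mulVKg.
case=> h Hh <-; exists x; first by exists 1; [exact: normal1|rewrite mulg1].
by exists (y * h); [exists h|rewrite mulgA].
Qed.

Lemma set_inv_left_coset x : set_inv (left_coset H x) = left_coset H x^-1.
Proof.
apply/seteqP; split=> z /=.
  case=> _ [h Hh <-] <-; rewrite left_cosetE invgK invgM.
  have -> : x * (h^-1 * x^-1) = h^-1 ^ x^-1 by rewrite /conjg invgK.
  exact/normalJ/normalV.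
case=> h Hh <-; exists (h^-1 * x); last by rewrite invgM invgK.
by rewrite left_cosetE; apply/normalJ/normalV.
Qed.

Record quotient_group (N : is_normal H) := Coset {
  coset_set : set G;
  coset_setP : coset_set \in left_cosets H }.

Implicit Type N : is_normal H.

HB.instance Definition _ N := [isSub for @coset_set N].
HB.instance Definition _ N := [Choice of quotient_group N by <:].

End NormalTheory.

Section QuotientGroup.
Variables (H : set G) (nH : is_normal H).
Local Notation Q := (quotient_group nH).
Implicit Types c d e : Q.

Lemma cosetP c : exists x, coset_set c = left_coset H x.
Proof. by case: c => C /= /set_mem[x _ <-]; exists x. Qed.

Fact quotient_one_subproof : H \in left_cosets H.
Proof. by apply/mem_set; exists 1 => //; apply: left_coset1. Qed.

Fact quotient_mul_subproof c d :
  set_mul (coset_set c) (coset_set d) \in left_cosets H.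
Proof.
have [x ->] := cosetP c; have [y ->] := cosetP d.
by apply/mem_set; exists (x * y); rewrite ?set_mul_left_coset.
Qed.

Fact quotient_inv_subproof c : set_inv (coset_set c) \in left_cosets H.
Proof.
have [x ->] := cosetP c.
by apply/mem_set; exists x^-1; rewrite ?set_inv_left_coset.
Qed.

Definition quotient_one : Q := Coset nH quotient_one_subproof.
Definition quotient_mul c d : Q := Coset nH (quotient_mul_subproof c d).
Definition quotient_inv c : Q := Coset nH (quotient_inv_subproof c).

Fact quotient_mulA : associative quotient_mul.
Proof.
move=> c d e; apply/val_inj => /=.
have [x ->] := cosetP c; have [y ->] := cosetP d; have [z ->] := cosetP e.
by rewrite !set_mul_left_coset // mulgA.
Qed.

Fact quotient_mul1 : left_id quotient_one quotient_mul.
Proof.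
move=> c; apply/val_inj => /=; have [x ->] := cosetP c.
by rewrite -{1}(left_coset1 H) set_mul_left_coset // mul1g.
Qed.

Fact quotient_mulr1 : right_id quotient_one quotient_mul.
Proof.
move=> c; apply/val_inj => /=; have [x ->] := cosetP c.
by rewrite -{2}(left_coset1 H) set_mul_left_coset // mulg1.
Qed.

Fact quotient_mulV : left_inverse quotient_one quotient_inv quotient_mul.
Proof.
move=> c; apply/val_inj => /=; have [x ->] := cosetP c.
by rewrite set_inv_left_coset // set_mul_left_coset // mulVg left_coset1.
Qed.

Fact quotient_mulrV : right_inverse quotient_one quotient_inv quotient_mul.
Proof.
move=> c; apply/val_inj => /=; have [x ->] := cosetP c.
by rewrite set_inv_left_coset // set_mul_left_coset // mulgV left_coset1.
Qed.

End QuotientGroup.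

HB.instance Definition _ H (nH : is_normal H) :=
  isGroup.Build (quotient_group nH) (@quotient_mulA H nH) (@quotient_mul1 H nH)
    (@quotient_mulr1 H nH) (@quotient_mulV H nH) (@quotient_mulrV H nH).

End Groups.

Arguments finitely_generated : clear implicits.

Definition isomorphic (G K : groupType) : Prop :=
  exists f : {multiplicative G -> K}, bijective f.

(* As a multiplicative [groupType], 'Z_2 has addition modulo 2 as its law; the
   law on [{ffun 'I_n -> 'Z_2}] is pointwise. *)
Definition C2pow (n : nat) : groupType := {ffun 'I_n -> 'Z_2}.

(* Main.v *)
(* Let [G] act on the cosets of [H], with [x] a generating [n]-tuple and [H] free
   of primitive elements. If [k] lies in the span of some entries of [x] and
   [x i] is another entry, then [k^-1 * x i] is primitive, hence so are its
   conjugates, and it fixes no coset; so [x i] moves each point out of its orbit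
   under that span. By induction the orbits of the span of [m] entries have at
   least [2 ^ m] points. As the index is less than [3 * 2 ^ n.-1], the span of the
   entries other than [x i] has exactly two orbits, swapped by [x i]: this gives a
   parity [G -> C_2] that sends [x j] to [i == j] and kills [H]. The [n] parities
   form a surjection onto [C_2^n], and counting shows that its kernel is [H].
   A coset other than [H] with parity vector [J] contains the product of the
   [x i] with [i] in [J], which is primitive because [J] is nonempty. Conversely,
   a primitive element of [H] would let [n - 1] elements generate [C_2^n]. *)

Require Import Defs.
From mathcomp Require Import all_boot.
From mathcomp Require Import finmap.
From mathcomp Require Import all_classical.
From HB Require Import structures.
From mathcomp Require Import ssralg zmodp.

Set Implicit Arguments.
Unset Strict Implicit.
Unset Printing Implicit Defensive.

Local Open Scope classical_set_scope.
Local Open Scope group_scope.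

(** * Subgroups generated by a set *)

Section Subgroups.
Variable G : groupType.
Implicit Types (A H M : set G) (x y : G).

Lemma subgroup_closed M : M 1 -> (forall x y, M x -> M y -> M (x / y)) -> is_subgroup M.
Proof.
by move=> M1 MF; split=> [|x y /set_mem Mx /set_mem My]; apply/mem_set; auto.
Qed.

Lemma subgroup1 M : is_subgroup M -> M 1.
Proof. by case=> /set_mem. Qed.

Lemma subgroupF M x y : is_subgroup M -> M x -> M y -> M (x / y).
Proof. by case=> _ MF Mx My; apply/set_mem/MF; apply/mem_set. Qed.

Lemma subgroupV M x : is_subgroup M -> M x -> M x^-1.
Proof.
by move=> sM Mx; rewrite -div1g; apply: subgroupF => //; apply: subgroup1.
Qed.

Lemma subgroupM M x y : is_subgroup M -> M x -> M y -> M (x * y).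
Proof.
move=> sM Mx My; rewrite -[y]invgK; apply: subgroupF => //.
exact: subgroupV.
Qed.

Lemma gen_subgroup_min A M : is_subgroup M -> A `<=` M -> gen_subgroup A `<=` M.
Proof. by move=> sM AM; apply: smallest_sub. Qed.

Lemma sub_gen_subgroup A : A `<=` gen_subgroup A.
Proof. by move=> x Ax M [_]; apply. Qed.

Lemma gen_subgroupP A : is_subgroup (gen_subgroup A).
Proof.
apply: subgroup_closed => [M [sM _]|x y Ax Ay M AM]; first exact: subgroup1.
by apply: subgroupF; [case: AM|apply: Ax|apply: Ay].
Qed.

End Subgroups.

(** * Spanning tuples and primitive elements *)

Section Families.
Variables (G : groupType) (n : nat).
Implicit Types (x : 'I_n -> G) (J : {set 'I_n}) (H : set G).

Definition span x J : set G := gen_subgroup (x @` [set` J]).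

Lemma span_subgroup x J : is_subgroup (span x J).
Proof. exact: gen_subgroupP. Qed.
Hint Resolve span_subgroup : core.

Lemma span1 x J : span x J 1.
Proof. exact: subgroup1. Qed.

Lemma spanV x J g : span x J g -> span x J g^-1.
Proof. exact: subgroupV. Qed.

Lemma spanM x J g h : span x J g -> span x J h -> span x J (g * h).
Proof. exact: subgroupM. Qed.

Lemma spanF x J g h : span x J g -> span x J h -> span x J (g / h).
Proof. exact: subgroupF. Qed.

Lemma mem_span x J i : i \in J -> span x J (x i).
Proof. by move=> Ji; apply: sub_gen_subgroup; exists i. Qed.

Lemma span_sub x J M : is_subgroup M -> (forall i, i \in J -> M (x i)) -> span x J `<=` M.
Proof. by move=> sM xM; apply: gen_subgroup_min => // _ [i Ji <-]; apply: xM. Qed.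

Lemma spanS x J J' : J \subset J' -> span x J `<=` span x J'.
Proof.
by move=> sJJ'; apply: span_sub => // i /(fintype.subsetP sJJ'); apply: mem_span.
Qed.

Definition spanning x : Prop := forall g, span x [set: 'I_n]%SET g.

Lemma spanning_ind x M :
  spanning x -> is_subgroup M -> (forall i, M (x i)) -> forall g, M g.
Proof. by move=> sx sM xM g; apply: span_sub (sx g). Qed.

Lemma spanning_conj x g : spanning x -> spanning (fun i => x i ^ g).
Proof.
set y := fun i => _; move=> sx h.
rewrite -[h](conjgKV g).
apply: (spanning_ind (M := fun k => span y [set: 'I_n]%SET (k ^ g)) sx).
  apply: subgroup_closed => [|a b]; first by rewrite conj1g; apply: span1.
  by move=> ya yb; rewrite conjMg conjVg; apply: spanF.
by move=> i; apply: (mem_span (x := y) (finset.in_setT i)).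
Qed.

(** [x i] is recovered from the new entry by cancelling [a] and [b], which lie in the span of the
    unchanged entries. *)
Lemma spanning_replace x i a b : spanning x ->
    span x [set~ i]%SET a -> span x [set~ i]%SET b ->
  spanning (fun j => if j == i then a * x i * b else x j).
Proof.
set y := fun j => _; move=> sx xa xb.
have sub : span x [set~ i]%SET `<=` span y [set: 'I_n]%SET.
  apply: span_sub => // j; rewrite !inE => ji.
  by have := mem_span (x := y) (finset.in_setT j); rewrite /y (negPf ji).
apply: (spanning_ind sx (span_subgroup y _)) => j; have [->|ji] := eqVneq j i; last first.
  by apply: sub; apply: mem_span; rewrite !inE.
have -> : x i = a^-1 * (a * x i * b) / b by rewrite -!mulgA mulgV mulg1 mulKg.
apply: spanF => //; last exact: sub.
apply: spanM => //; first exact: spanV (sub _ xa).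
by have := mem_span (x := y) (finset.in_setT i); rewrite /y eqxx.
Qed.

(** Entries may repeat a priori; when [n] is the rank, [primitive_eltP] identifies this with
    [primitive_elt]. *)
Definition tuple_primitive g : Prop := exists2 x, spanning x & exists i, x i = g.

Lemma tuple_primitiveJ g h : tuple_primitive g -> tuple_primitive (g ^ h).
Proof.
case=> x sx [i <-]; exists (fun i => x i ^ h); last by exists i.
exact: spanning_conj.
Qed.

Lemma tuple_primitive_mul x i a b : spanning x ->
    span x [set~ i]%SET a -> span x [set~ i]%SET b ->
  tuple_primitive (a * x i * b).
Proof.
move=> sx xa xb; exists (fun j => if j == i then a * x i * b else x j).
  exact: spanning_replace.
by exists i; rewrite eqxx.
Qed.

Definition subset_prod x J : G := \prod_(i <- enum 'I_n | i \in J) x i.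

Lemma span_prod x J (r : seq 'I_n) (P : pred 'I_n) :
  {subset r <= J} -> span x J (\prod_(i <- r | P i) x i).
Proof.
elim: r => [|i r IHr] rJ; first by rewrite big_nil; apply: span1.
have xr : span x J (\prod_(i <- r | P i) x i).
  by apply: IHr => j rj; apply: rJ; rewrite inE rj orbT.
rewrite big_cons; case: ifP => // _; apply: spanM => //.
by apply: mem_span; apply: rJ; rewrite mem_head.
Qed.

(** Splitting the product at [i] gives the form [a * x i * b], where [a] and [b] avoid [x i] because
    [enum 'I_n] has no repetition. *)
Lemma subset_prod_primitive x J i : spanning x -> i \in J ->
  tuple_primitive (subset_prod x J).
Proof.
move=> sx Ji; rewrite /subset_prod.
have := mem_enum 'I_n i; have := enum_uniq 'I_n.
move: (enum 'I_n) => r r_uniq ri; move: r_uniq; case/splitPr: ri => r1 r2.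
rewrite cat_uniq /= negb_or => /and4P[_ /andP[ir1 _] ir2 _].
rewrite big_cat big_cons /= Ji mulgA.
by apply: tuple_primitive_mul => //; apply: span_prod => j rj; rewrite !inE;
  apply: contraTneq rj => ->.
Qed.

End Families.

(** * Orbits on the cosets and parities *)

Lemma cardsU_disjoint (T : finType) (A B : {set T}) :
  [disjoint A & B]%B -> #|A :|: B|%SET = (#|A| + #|B|)%N.
Proof. by move=> dAB; apply/eqP; rewrite (leq_card_setU A B).2. Qed.

Section Parity.
Variables (G : groupType) (n : nat) (H : set G) (sH : is_subgroup H).
Hypothesis H_imprimitive : forall g, H g -> ~ tuple_primitive n g.
(* [X] plays the role of the set of left cosets of [H], and [f] that of the projection. *)
Variables (X : finType) (f : G -> X).
Hypothesis fE : forall g h, f g = f h <-> H (g^-1 * h).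
Variables (x : 'I_n -> G) (sx : spanning x).

Lemma coset_mull k g h : f g = f h -> f (k * g) = f (k * h).
Proof. by move/fE => Hgh; apply/fE; rewrite invgM -mulgA mulKg. Qed.

(** Equality would put a conjugate of [a^-1 * x i * b], hence a primitive element, in [H]. *)
Lemma coset_neq i a b g : span x [set~ i]%SET a -> span x [set~ i]%SET b ->
  f (a * g) <> f (x i * (b * g)).
Proof.
move=> xa xb /fE.
have -> : (a * g)^-1 * (x i * (b * g)) = (a^-1 * x i * b) ^ g.
  by rewrite /conjg invgM !mulgA.
move/H_imprimitive; apply; apply/tuple_primitiveJ/tuple_primitive_mul => //.
exact: (spanV xa).
Qed.

(** Written through representatives, as no action on [X] is defined: this is the orbit of the coset
    [f g] under the span of [J]. *)
Definition orb (J : {set 'I_n}) g : {set X} :=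
  [set y | `[< exists2 k, span x J k & f (k * g) = y >]]%SET.

Lemma orbP J g y : reflect (exists2 k, span x J k & f (k * g) = y) (y \in orb J g).
Proof. by rewrite finset.inE; apply: asboolP. Qed.

Lemma orb_refl J g : f g \in orb J g.
Proof.
by apply/orbP; exists 1; [exact: span1|rewrite mul1g].
Qed.

Lemma orb_mull J k g h : span x J k -> (f (k * g) \in orb J h) = (f g \in orb J h).
Proof.
have half k' g' : span x J k' -> f g' \in orb J h -> f (k' * g') \in orb J h.
  move=> xk /orbP[l xl lg]; apply/orbP; exists (k' * l).
    exact: spanM.
  by rewrite -mulgA; apply: coset_mull.
move=> xk; apply/idP/idP; last exact: half.
rewrite -{2}[g](mulKg k); apply: half; exact: spanV.
Qed.

Lemma disjoint_orb J g h : f g \notin orb J h -> [disjoint orb J h & orb J g]%B.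
Proof.
move=> gh; rewrite disjoint_sym; apply/fintype.pred0P => y /=.
by apply/negP => /andP[/orbP[k xk <-]]; rewrite orb_mull // (negPf gh).
Qed.

Lemma step_notin_orb (J : {set 'I_n}) i g : i \notin J -> f (x i * g) \notin orb J g.
Proof.
move=> iJ; apply/orbP => -[k xk] /esym.
have sJ : J \subset [set~ i]%SET
    by apply/fintype.subsetP => j; rewrite !finset.inE; apply: contraTneq => ->.
have x1 : span x [set~ i]%SET 1 by apply: span1.
move/esym; rewrite -[in x i * g](mul1g g); apply: coset_neq => //.
exact: spanS xk.
Qed.

(** For [i] in [J], the orbits of [g] and [x i * g] under the span without [i] are disjoint and lie
    in the orbit for [J], so the bound doubles with each index. *)
Lemma card_orb (J : {set 'I_n}) g : (2 ^ #|J| <= #|orb J g|)%N.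
Proof.
have [m] := ubnP #|J|; elim: m J g => // m IHm J g Jm.
have [->|[i Ji]] := finset.set_0Vmem J.
  by rewrite cards0 card_gt0; apply/set0Pn; exists (f g); apply: orb_refl.
have sub : (J :\ i)%SET \subset J by apply: finset.subD1set.
have lt_m : #|(J :\ i)%SET| < m by move: Jm; rewrite (cardsD1 i) Ji.
rewrite (cardsD1 i) Ji expnS mul2n -addnn.
have dis : [disjoint orb (J :\ i)%SET g & orb (J :\ i)%SET (x i * g)]%B.
  by apply/disjoint_orb/step_notin_orb; rewrite !finset.inE eqxx.
apply: leq_trans (leq_add (IHm _ g lt_m) (IHm _ (x i * g) lt_m)) _.
rewrite -cardsU_disjoint //.
apply/subset_leq_card/fintype.subsetP => y; rewrite finset.inE => /orP[] /orbP[k xk <-].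
  by apply/orbP; exists k => //; exact: spanS xk.
rewrite mulgA; apply/orbP; exists (k * x i) => //.
by apply: spanM; [exact: spanS xk|exact: mem_span].
Qed.

Hypothesis cardX : (#|X| < 3 * 2 ^ n.-1)%N.

(* Three pairwise disjoint orbits of [span x [set~ i]] would need [3 * 2 ^ n.-1]
   points, so there are only two, and multiplication by [x i] swaps them. *)
Definition parity i g := f g \notin orb [set~ i]%SET 1.

Lemma parity_step i g : parity i (x i * g) = ~~ parity i g.
Proof.
rewrite /parity negbK; set J := [set~ i]%SET.
have iJ : i \notin J by rewrite !finset.inE eqxx.
apply/idP/idP => [|/orbP[b xb]]; last first.
  (* The cosets of [g] and [x i * g] cannot both lie in the orbit of 1: this would give
     [f a = f (x i * b)] with [a] and [b] in the span. *)
  rewrite mulg1 => gb; apply/negP => /orbP[a xa]; rewrite (coset_mull _ (esym gb)).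
  by rewrite -[b]mulg1; apply: coset_neq.
(* Otherwise the orbits of 1, [g] and [x i * g] are the three disjoint ones. *)
apply: contraLR => g1; rewrite negbK; apply/contraT => xg1.
have cardJ : #|J| = n.-1 by rewrite cardsC1 card_ord.
have d1 := disjoint_orb g1; have d2 := disjoint_orb xg1.
have d3 := disjoint_orb (step_notin_orb g iJ).
have dU : [disjoint (orb J 1 :|: orb J g)%SET & orb J (x i * g)]%B
  by rewrite finset.disjoints_subset finset.subUset -!finset.disjoints_subset d2.
suff : (3 * 2 ^ n.-1 <= #|X|)%N by rewrite leqNgt cardX.
apply: leq_trans (max_card (orb J 1 :|: orb J g :|: orb J (x i * g))%SET).
rewrite !cardsU_disjoint //.
by rewrite !mulSn addn0 addnA !leq_add // -cardJ card_orb.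
Qed.

Lemma parity1 i : parity i 1 = false.
Proof. by rewrite /parity orb_refl. Qed.

(** The [g] satisfying this for every [h] form a subgroup containing the generators: [x i] flips the
    parity, and the other [x j] preserve the orbits. *)
Lemma parityM i g h : parity i (g * h) = parity i g (+) parity i h.
Proof.
move: g h; apply: (spanning_ind (M := fun g => forall h, _) sx).
  apply: subgroup_closed => [h|a b pa pb h]; first by rewrite mul1g parity1.
  (* Additivity of [b] at [b^-1 * h] and at [b^-1] gives that of [b^-1]. *)
  have := pb (b^-1 * h); have := pb b^-1; rewrite -mulgA !pa mulVKg mulgV parity1.
  by case: (parity i b) (parity i b^-1) => -[] // _ ->;
    case: (parity i a) (parity i (b^-1 * h)) => -[].
move=> j h; have [->|ji] := eqVneq j i.
  by rewrite -[in parity _ (x i)](mulg1 (x i)) !parity_step parity1.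
have xj : span x [set~ i]%SET (x j) by apply: mem_span; rewrite !finset.inE.
by rewrite /parity orb_mull // -[x j]mulg1 orb_mull // orb_refl.
Qed.

Lemma parity_gen i j : parity i (x j) = (i == j).
Proof.
have [<-|ij] := eqVneq; first by rewrite -[x i]mulg1 parity_step parity1.
have xj : span x [set~ i]%SET (x j) by apply: mem_span; rewrite !finset.inE eq_sym.
by rewrite /parity -[x j]mulg1 orb_mull // orb_refl.
Qed.

Lemma parity_subset_prod i J : parity i (subset_prod x J) = (i \in J).
Proof.
rewrite (big_morph _ (parityM i) (parity1 i)) big_enum_cond /=.
under eq_bigr do rewrite parity_gen.
have [iJ|iJ] := boolP (i \in J).
  by rewrite (bigD1 i) //= eqxx big1 // => j /andP[_]; rewrite eq_sym => /negPf.
by rewrite big1 // => j jJ; apply: contraNF iJ => /eqP ->.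
Qed.

(** For positive [n], if some [g] outside [H] had only zero parities, the subset products and their
    right multiples by [g] would represent [2 * 2 ^ n = 4 * 2 ^ n.-1] distinct cosets, too many. *)
Lemma parity_kernel g : H g <-> forall i, parity i g = false.
Proof.
split=> [Hg i|g0].
  by rewrite /parity (fE g 1).2 ?orb_refl // mulg1; apply: subgroupV.
(* For [n = 0] the bound is 3 and the count yields only 2 cosets; but the empty tuple spans only the
   trivial group. *)
case: (posnP n) => [n0|n_gt0].
  apply: (spanning_ind sx sH) => i.
  by have := ltn_ord i; rewrite {2}n0.
apply: contrapT => Hg; pose F (p : {set 'I_n} * bool) :=
  f (subset_prod x p.1 * (if p.2 then g else 1)).
suff /leq_card : injective F.
  rewrite card_prod card_bool -(cardsT {set 'I_n}) -powersetT card_powerset cardsT card_ord.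
  move=> /leq_ltn_trans/(_ cardX).
  by rewrite -{1}(prednK n_gt0) expnS mulnAC ltn_pmul2r ?expn_gt0.
move=> [J b] [K c]; rewrite /F /= => eqF.
(* Parities depend only on the coset, and neither [g] nor 1 contributes to them, so they recover the
   subset. *)
have eqJK : J = K.
  apply/setP => i; have := congr1 (fun y => y \notin orb [set~ i]%SET 1) eqF.
  rewrite -!/(parity _ _) !parityM !parity_subset_prod.
  by case: b c {eqF} => -[]; rewrite ?g0 ?parity1 !addbF.
congr pair => //; move: eqF; rewrite -eqJK => /(coset_mull (subset_prod x J)^-1).
rewrite !mulKg; case: b c => -[] // => /fE; rewrite ?mulg1 ?invg1 ?mul1g // => HV.
by case: Hg; rewrite -[g]invgK; apply: subgroupV.
Qed.

End Parity.

(** * Cosets, generating sets as tuples, and generators of C_2^n *)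

Lemma left_coset_eq (G : groupType) (H : set G) (sH : is_subgroup H) g h :
  left_coset H g = left_coset H h <-> H (g^-1 * h).
Proof.
split=> [gh|Hgh].
  by rewrite -left_cosetE gh left_cosetE mulVg; apply: subgroup1.
apply/funext => k; rewrite !left_cosetE; apply/propext.
have -> : g^-1 * k = g^-1 * h * (h^-1 * k) by rewrite -mulgA mulVKg.
split=> Hk; last exact: subgroupM.
by rewrite -[h^-1 * k](mulKg (g^-1 * h)); apply: subgroupM => //; apply: subgroupV.
Qed.

(** Since [A] has [n] elements, each occurs at an index below [n], and the default 1 of [nth] is
    never reached. *)
Lemma spanning_nth (G : groupType) n (A : {fset G}) :
  generates A -> #|` A| = n -> spanning (fun i : 'I_n => nth 1 A i).
Proof.
move=> genA cardA h; have : [set: G] h by [].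
rewrite -genA; apply: gen_subgroup_min; first exact: span_subgroup.
move=> a /= Aa; have lt_a : (index a A < n)%N by rewrite -cardA index_mem.
have := mem_span (x := fun i : 'I_n => nth 1 A i) (finset.in_setT (Ordinal lt_a)).
by rewrite /= nth_index.
Qed.

Lemma primitive_eltP (G : groupType) (fgG : finitely_generated G) n g :
  group_rank fgG = n -> primitive_elt fgG g <-> tuple_primitive n g.
Proof.
rewrite /primitive_elt => rG; rewrite rG; split.
  case=> A [genA cardA Ag]; exists (fun i => nth 1 A i).
    exact: spanning_nth.
  have lt_g : (index g A < n)%N by rewrite -cardA index_mem.
  by exists (Ordinal lt_g); rewrite /= nth_index.
case=> x sx [i <-]; exists [fset x j | j in 'I_n]%fset.
have genx : generates [fset x j | j in 'I_n]%fset.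
  apply/seteqP; split=> // h _; apply: (spanning_ind sx); first exact: gen_subgroupP.
  by move=> j; apply: sub_gen_subgroup; apply/imfsetP; exists j.
split=> //; last by apply/imfsetP; exists i.
(* The image of [x] has at most [n] elements, and at least [n] by minimality of the rank. *)
apply/eqP; rewrite eqn_leq; apply/andP; split.
  by apply: leq_trans (leq_imfset_card _ _ _) _; rewrite -[leqRHS](card_ord n) -?cardE.
rewrite -[leqLHS]rG /group_rank; case: ex_minnP => m _; apply.
by apply/asboolP; eexists; split; first exact: genx.
Qed.

(* [L] below is a surjective self-map of a finite type, hence injective, yet
   [theta (x i) = 1] makes it kill the [i]-th basis vector. *)
Lemma C2pow_surj_neq1 (G : groupType) n (theta : G -> C2pow n) (x : 'I_n -> G) :
    {morph theta : g h / g * h} -> (forall v, exists g, theta g = v) ->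
    spanning x -> forall i, theta (x i) <> 1.
Proof.
move=> thetaM theta_surj sx i xi1.
pose L (u : {ffun 'I_n -> 'Z_2}) : {ffun 'I_n -> 'Z_2} :=
  [ffun k => \sum_j u j * theta (x j) k]%R.
(* The [g] with [theta g] in the image of [L] form a subgroup containing the generators, so
   surjectivity passes from [theta] to [L]. *)
have L_surj v : exists u, L u = v.
  have [g <-] := theta_surj v; move: g; apply: (spanning_ind sx).
    have theta1 : theta 1 = 1 by apply: (mulgI (theta 1)); rewrite -thetaM !mulg1.
    have thetaV h : theta h^-1 = (theta h)^-1.
      by apply: (mulgI (theta h)); rewrite -thetaM !mulgV theta1.
    apply: subgroup_closed => [|g h [u Lu] [v' Lv]].
      exists 0%R; rewrite theta1; apply/ffunP => k; rewrite !ffunE big1 // => j _.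
      by rewrite ffunE GRing.mul0r.
    exists (u - v')%R; rewrite thetaM thetaV -Lu -Lv; apply/ffunP => k.
    rewrite !ffunE; under eq_bigr do rewrite !ffunE GRing.mulrBl.
    by rewrite GRing.sumrB.
  move=> j; exists [ffun l => (l == j)%:R]%R; apply/ffunP => k; rewrite ffunE.
  rewrite (bigD1 j) //= big1 => [|l lj]; rewrite ffunE ?eqxx ?GRing.mul1r ?GRing.addr0 //.
  by rewrite (negPf lj) GRing.mul0r.
have [r rK] := choice L_surj.
have := @can_inj _ _ _ _ (canF_sym rK) [ffun l => (l == i)%:R]%R 0%R.
have -> : L [ffun l => (l == i)%:R]%R = L 0%R.
  apply/ffunP => k; rewrite !ffunE !big1 // => j _; rewrite ffunE ?GRing.mul0r //.
  have [->|] := eqVneq j i; last by rewrite GRing.mul0r.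
  by rewrite xi1 ffunE GRing.mulr0.
by move/(_ erefl)/ffunP/(_ i); rewrite !ffunE eqxx.
Qed.

(** * Imprimitive subgroups and quotients isomorphic to C_2^n *)

Section Characterization.
Variables (G : groupType) (n : nat) (H : set G) (sH : is_subgroup H).
Hypothesis finH : finite_set (left_cosets H).
Variables (x : 'I_n -> G) (sx : spanning x).

(** The projection followed by the isomorphism is a surjective morphism that kills [H], but by
    [C2pow_surj_neq1] it kills no entry of a spanning tuple. *)
Lemma C2pow_quotient_imprimitive (nH : is_normal H) g :
  isomorphic (quotient_group nH) (C2pow n) -> H g -> ~ tuple_primitive n g.
Proof.
case=> f bij_f Hg [y sy [i yi]].
pose proj h : quotient_group nH := Coset nH (mem_set (imageT (left_coset H) h)).
have projM : {morph proj : h k / h * k}.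
  by move=> h k; apply/val_inj; rewrite /= set_mul_left_coset.
apply: (@C2pow_surj_neq1 G n (fun h => f (proj h)) y _ _ sy i).
- by move=> h k; rewrite projM gmulfM.
- case: bij_f => f' fK f'K v; have [h f'v] := cosetP (f' v).
  by exists h; rewrite -[v]f'K; congr (f _); apply/val_inj; rewrite /= f'v.
rewrite yi; have -> : proj g = 1.
  apply/val_inj => /=; rewrite -[RHS](left_coset1 H); apply/left_coset_eq => //.
  by rewrite mulg1; apply: subgroupV.
by apply: (mulgI (f 1)); rewrite -gmulfM !mulg1.
Qed.

Hypothesis indexH : (subgroup_index H < 3 * 2 ^ n.-1)%N.
Hypothesis H_imprimitive : forall g, H g -> ~ tuple_primitive n g.

Lemma imprimitive_parity : exists phi : 'I_n -> G -> bool,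
  [/\ forall i, {morph phi i : g h / g * h >-> g (+) h},
      forall i J, phi i (subset_prod x J) = (i \in J)
    & forall g, H g <-> forall i, phi i g = false].
Proof.
(* The left cosets, taken as a finite type, play the role of [X]; its cardinal is the index. *)
pose A := fset_set (left_cosets H).
have memA g : left_coset H g \in A by rewrite in_fset_set //; apply/mem_set/imageT.
pose f g : A := [` memA g]%fset.
have fE g h : f g = f h <-> H (g^-1 * h).
  rewrite -left_coset_eq //; split=> [/(congr1 val)//|gh].
  exact: val_inj.
have cardA : (#|{: A}| < 3 * 2 ^ n.-1)%N by rewrite -cardfE.
exists (parity f x); split.
- exact: (parityM H_imprimitive fE sx cardA).
- exact: (parity_subset_prod H_imprimitive fE sx cardA).
- exact: (parity_kernel sH H_imprimitive fE sx cardA).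
Qed.

(** Parities are invariant under conjugation, so [H] is normal; they separate the cosets, and subset
    products realize every parity vector. *)
Lemma imprimitive_quotient : exists nH : is_normal H,
  isomorphic (quotient_group nH) (C2pow n).
Proof.
have [phi [phiM phi_prod phiH]] := imprimitive_parity.
have phi1 i : phi i 1 = false by exact: ((phiH 1).1 (subgroup1 sH) i).
have phiV i g : phi i g^-1 = phi i g.
  by have := phiM i g g^-1; rewrite mulgV phi1; case: (phi i g) (phi i g^-1) => -[].
have phi_coset g h : left_coset H g = left_coset H h <-> forall i, phi i g = phi i h.
  rewrite left_coset_eq // phiH; split=> gh i; have := gh i; rewrite phiM phiV.
    by case: (phi i g) (phi i h) => -[].
  by move=> ->; rewrite addbb.
have nH : is_normal H.
  split=> // g h /phiH g0; apply/phiH => i.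
  by rewrite /conjg !phiM phiV g0 addbb.
exists nH.
pose rep (c : quotient_group nH) := projT1 (cid (cosetP c)).
have repE c : coset_set c = left_coset H (rep c) by rewrite /rep; case: cid.
pose f (c : quotient_group nH) : C2pow n :=
  [ffun i => if phi i (rep c) then 1%R else 0%R : 'Z_2].
have fM : {morph f : c d / c * d}.
  move=> c d; apply/ffunP => i; rewrite !ffunE.
  have -> : phi i (rep (c * d)) = phi i (rep c * rep d).
    by apply/(phi_coset _ _).1; rewrite -repE -set_mul_left_coset // -!repE.
  by rewrite phiM; do 2!case: (phi i _); apply/val_inj.
pose f_mul := isMultiplicative.Build _ _ f fM.
pose F : {multiplicative quotient_group nH -> C2pow n} := HB.pack f f_mul.
exists F.
(* The inverse sends [v] to the coset of the product over the support of [v]. *)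
pose f' (v : C2pow n) : quotient_group nH :=
  Coset nH (mem_set (imageT (left_coset H) (subset_prod x [set i | v i != 0%R]%SET))).
have phi_f' i v : phi i (rep (f' v)) = (v i != 0%R).
  rewrite -((phi_coset (subset_prod x [set i | v i != 0%R]%SET) _).1 _ i).
    by rewrite phi_prod finset.inE.
  by rewrite -repE.
exists f' => [c|v].
  apply/val_inj; rewrite /= repE; apply/phi_coset => i.
  by rewrite phi_prod finset.inE ffunE; case: (phi i _).
apply/ffunP => i; rewrite ffunE phi_f'.
by case: (v i) => -[|[|m]] p //; apply/val_inj.
Qed.

Lemma imprimitive_coset (C : set G) : left_cosets H C -> C <> H ->
  exists g, C g /\ tuple_primitive n g.
Proof.
have [phi [phiM phi_prod phiH]] := imprimitive_parity.
move=> [g _ <-] gH; pose J := [set i | phi i g]%SET.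
have [J0|[i Ji]] := finset.set_0Vmem J.
  case: gH; rewrite -[RHS]left_coset1; apply/left_coset_eq => //.
  rewrite mulg1; apply: subgroupV => //; apply/phiH => i; apply/negbTE/negP => gi.
  by have : i \in J by [rewrite finset.inE]; rewrite J0 finset.inE.
exists (subset_prod x J); split; last exact: subset_prod_primitive Ji.
(* By the choice of [J] the product has the parities of [g], so the sum becomes the parity of
   [g^-1 * g]. *)
rewrite left_cosetE; apply/phiH => j; rewrite phiM phi_prod finset.inE -phiM mulVg.
exact: ((phiH 1).1 (subgroup1 sH) j).
Qed.

End Characterization.

Local Close Scope group_scope.

Theorem theorem4p4 (G : groupType) (fgG : finitely_generated G) (n : nat)
    (rankG : group_rank fgG = n)
    (H : set G) (sH : is_subgroup H)
    (finH : finite_set (left_cosets H))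
    (indexH : subgroup_index H < 3 * 2 ^ n.-1) :
  ((~ exists x : G, H x /\ primitive_elt fgG x) <->
   (exists nH : is_normal H, isomorphic (quotient_group nH) (C2pow n))) /\
  ((exists nH : is_normal H, isomorphic (quotient_group nH) (C2pow n)) ->
   forall C : set G, left_cosets H C -> C <> H ->
   exists x : G, C x /\ primitive_elt fgG x).
Proof.
have [x sx] : exists x : 'I_n -> G, spanning x.
  move: rankG; rewrite /group_rank; case: ex_minnP => m /asboolP[A [genA cardA]] _ <-.
  by exists (fun i => nth 1%g A i); apply: spanning_nth.
(* This serves both the converse implication and the statement on cosets. *)
have imprim : (exists nH : is_normal H, isomorphic (quotient_group nH) (C2pow n)) ->
  forall g, H g -> ~ tuple_primitive n g.
  by case=> nH iso g; apply: C2pow_quotient_imprimitive iso.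
split; [split=> [noprim|/imprim Himp [g [Hg /(primitive_eltP _ rankG)]]]|].
- apply: imprimitive_quotient => // g Hg gprim; apply: noprim; exists g.
  by split=> //; apply/(primitive_eltP _ rankG).
- exact: Himp.
move=> /imprim Himp C CH CnH.
have [g [Cg gprim]] := imprimitive_coset sH finH sx indexH Himp CH CnH.
by exists g; split=> //; apply/(primitive_eltP _ rankG).
Qed.
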